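(* Let $D=(V,A)$ be a weak cycle on $n$ vertices, with vertices labeled in order around the cycle as $v_0,v_1,\dots,v_{n-1}$ (indices modulo $n$). Let $$V_-=\{i: (v_{i+1},v_i)\in A\text{ and }(v_i,v_{i+1})\notin A\},$$ $$V_+=\{j: (v_j,v_{j+1})\in A\text{ and }(v_{j+1},v_j)\notin A\},$$ $$V_0=\{k: (v_k,v_{k+1})\in A\text{ and }(v_{k+1},v_k)\in A\},$$ and suppose that $V_0$, $V_-$ and $V_+$ are all nonempty. Let $d(i,j)=j-i \bmod n\in\{0,1,\dots,n-1\}$ and set $\ell=\min\{d(i,j): i\in V_-,\ j\in V_+\}$. Then $$F(D)=n-1-\left\lfloor\frac{\ell}{2}\right\rfloor.$$
   Context: A finite simple digraph $D=(V,A)$ has finite nonempty vertex set $V$ and arc set $A$ consisting of ordered pairs of distinct vertices (no loops, no parallel arcs; both $(u,v)$ and $(v,u)$ may be present). $N_D^+(v)=\{u:(v,u)\in A\}$. A weak cycle is a digraph whose underlying undirected graph (replace each arc $(u,v)$ by the edge $\{u,v\}$) is a cycle; thus cyclically consecutive vertices $v_i,v_{i+1}$ are joined by one or both of the arcs $(v_i,v_{i+1}),(v_{i+1},v_i)$, and there are no other arcs. Zero forcing: for $S\subseteq V$ let $B^0(S)=S$ and $B^{i+1}(S)=B^i(S)\cup\{w:\{w\}=N_D^+(v)\setminus B^i(S)\text{ for some }v\in B^i(S)\}$. $S$ is a zero forcing set (ZFS) if $B^t(S)=V$ for some $t\ge 0$, and a failed zero forcing set (FZFS) otherwise. The failed zero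 forcing number $F(D)$ is the largest cardinality of an FZFS of $D$. *)

(* Defs.v *)
(* MathComp; boolp is used only to turn a Prop into a bool in \max. *)
From mathcomp Require Import all_boot.
From mathcomp Require Import boolp.

Set Implicit Arguments.
Unset Strict Implicit.
Unset Printing Implicit Defensive.

Record digraph (V : finType) := Digraph {
  arc :> rel V;
  arc_irr : irreflexive arc;
  vertices_gt0 : 0 < #|V| }.

Section ZeroForcing.
Variables (V : finType) (D : digraph V).

Definition out_nbhd (v : V) : {set V} := [set u | D v u].

Definition force_step (B : {set V}) : {set V} :=
  B :|: [set w | [exists v in B, [set w] == out_nbhd v :\: B]].

Definition zero_forcing_set (S : {set V}) : Prop :=
  exists t, iter t force_step S = [set: V].

Definition failed_zero_forcing_set (S : {set V}) : Prop :=
  ~ zero_forcing_set S.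

(* The maximum ranges over a nonempty family: force_step fixes set0, and V is
   nonempty, so set0 is a failed zero forcing set. *)
Definition failed_zero_forcing_number : nat :=
  \max_(S : {set V} | `[< failed_zero_forcing_set S >]) #|S|.

Definition underlying_edge (x y : V) : bool := D x y || D y x.

(* v enumerates the vertices in order around the cycle; ordS i is i + 1 mod n.
   A (simple, undirected) cycle has at least 3 vertices. *)
Definition weak_cycle_labeling (n : nat) (v : 'I_n -> V) : Prop :=
  [/\ 2 < n, bijective v &
      forall i j : 'I_n,
        underlying_edge (v i) (v j) = (j == ordS i) || (i == ordS j)].

Variables (n : nat) (v : 'I_n -> V).

Definition V_minus : {set 'I_n} :=
  [set i | D (v (ordS i)) (v i) && ~~ D (v i) (v (ordS i))].

Definition V_plus : {set 'I_n} :=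
  [set j | D (v j) (v (ordS j)) && ~~ D (v (ordS j)) (v j)].

Definition V_zero : {set 'I_n} :=
  [set k | D (v k) (v (ordS k)) && D (v (ordS k)) (v k)].

End ZeroForcing.

(* j - i mod n; n is added before subtracting because nat subtraction
   truncates. *)
Definition cyc_dist (n : nat) (i j : 'I_n) : nat := (j + n - i) %% n.

(* Every cyc_dist is smaller than n, so the default value n is irrelevant when
   I and J are nonempty. *)
Definition min_cyc_dist (n : nat) (I J : {set 'I_n}) : nat :=
  \big[minn/n]_(i in I) \big[minn/n]_(j in J) cyc_dist i j.

(* Main.v *)
(* A failed set S of maximum size is closed under forcing: every vertex of S
   has either no or two out-neighbours in W = V \ S.  If no two consecutive
   vertices lie in S, then |W| >= n / 2 > l / 2.  Otherwise some vertex of W is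
   preceded by two vertices of S; going forward from it to the next two
   consecutive vertices of S gives a stretch v_{i+1}, ..., v_j whose end vertices
   lie in W and which has no two consecutive vertices in S.  Closedness at its
   ends forces i in V_- and j in V_+, so j - i >= l, and more than half of the
   stretch lies in W.  Conversely, every second vertex of a shortest such
   stretch, together with its last vertex, is the complement of a closed set. *)

Require Import Defs.
From mathcomp Require Import all_boot.
From mathcomp Require Import all_order boolp zify.

Import Order.TTheory.

Set Implicit Arguments.
Unset Strict Implicit.
Unset Printing Implicit Defensive.

(** * Sets closed under forcing *)

Section Stalled.
Variables (V : finType) (D : digraph V).
Implicit Types S : {set V}.

Definition stalled S := force_step D S == S.

Lemma stalledP S :
  reflect (forall x y, x \in S -> y \notin S -> D x y ->
             exists2 z, z \notin S & (z != y) && D x z)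
          (stalled S).
Proof.
apply: (iffP eqP) => [fixS x y xS yS Dxy | H].
  case: (pickP [pred z | (z \notin S) && ((z != y) && D x z)])
    => [z /andP[zS ?] | none]; first by exists z.
  have := yS; rewrite -{1}fixS !inE negb_or => /andP[_ /existsP[]].
  exists x; rewrite xS /=; apply/eqP/setP => z; rewrite !inE.
  have /= := none z; case: eqVneq => [->|_] /=; first by rewrite yS.
  by move=> ->.
apply/setP => y; rewrite !inE; case: (boolP (y \in S)) => //= yS.
apply/existsP => -[x /andP[xS /eqP E]].
have Ez z : (z == y) = (z \notin S) && D x z.
  by move/setP: E => /(_ z); rewrite !inE.
have Dxy : D x y by have := Ez y; rewrite eqxx => /esym/andP[].
have [z zS /andP[zy Dxz]] := H x y xS yS Dxy.
by have := Ez z; rewrite (negPf zy) zS Dxz.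
Qed.

Lemma stalled_failed S : stalled S -> S != setT -> failed_zero_forcing_set D S.
Proof. by move=> /eqP fixS SneqT [t]; rewrite iter_fix // => /eqP; apply/negP. Qed.

Lemma failed_neqT S : failed_zero_forcing_set D S -> S != setT.
Proof. by move=> failS; apply/eqP => ST; apply: failS; exists 0. Qed.

Lemma stalled_leq S :
  stalled S -> S != setT -> #|S| <= failed_zero_forcing_number D.
Proof.
move=> stS ST; apply: (leq_bigmax_cond (P := fun S => `[< _ S >])).
exact/asboolP/stalled_failed.
Qed.

(* A failed set of maximum size is stalled, since one more forcing step would
   again give a failed set. *)
Lemma failed_number_stalled :
  exists2 S, stalled S && (S != setT) & #|S| = failed_zero_forcing_number D.
Proof.
pose failed := [pred S | `[< failed_zero_forcing_set D S >]].
have failed_gt0 : 0 < #|failed|.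
  apply/card_gt0P; exists set0; apply/asboolP; apply: stalled_failed.
    by apply/stalledP => x y; rewrite inE.
  apply/eqP => /setP set0T; have /card_gt0P[x _] := vertices_gt0 D.
  by have := set0T x; rewrite !inE.
have [S /asboolP failS maxS] := eq_bigmax_cond (fun S => #|S|) failed_gt0.
exists S; last by rewrite -maxS.
rewrite failed_neqT // andbT /stalled eq_sym eqEcard subsetUl /= -maxS.
apply: (leq_bigmax_cond (P := fun S => S \in failed)).
by apply/asboolP => -[t Et]; apply: failS; exists t.+1; rewrite iterSr.
Qed.

End Stalled.

(** The extra term [g m] carries the induction: if [g m.+1] fails, then [g m] holds, and its unit
    pays for the longer range. *)
Lemma half_density (g : nat -> bool) m :
    g 0 -> (forall k, k < m -> g k.+1 || g k.+2) ->
  m + g m < 2 * \sum_(k < m.+1) g k.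
Proof.
move=> g0; elim: m => [|m IHm] gP; first by rewrite big_ord1 g0.
have {}IHm := IHm (fun k lt_km => gP k (ltnW lt_km)).
rewrite big_ord_recr /=.
have : g m || g m.+1 by case: m {IHm} gP => [|m] gP; [rewrite g0 | exact: gP].
by move: IHm; case: (g m); case: (g m.+1) => //=; lia.
Qed.

(** * Closed sets on a weak cycle *)

Section WeakCycle.
(** [w] runs around the cycle with period [n], so that a stretch passing the starting vertex is
    still an interval of natural numbers. *)
Variables (V : finType) (D : digraph V) (n : nat) (w : nat -> V).
Hypothesis n_gt2 : 2 < n.
Hypothesis w_eq : forall a b, (w a == w b) = (a == b %[mod n]).
Hypothesis w_surj : forall x, exists k, x = w k.
Hypothesis w_edge : forall a b,
  underlying_edge D (w a) (w b) = (w b == w a.+1) || (w a == w b.+1).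

Definition minus k := D (w k.+1) (w k) && ~~ D (w k) (w k.+1).
Definition plus k := D (w k) (w k.+1) && ~~ D (w k.+1) (w k).
Definition both k := D (w k) (w k.+1) && D (w k.+1) (w k).

Lemma edge_next k : D (w k) (w k.+1) || D (w k.+1) (w k).
Proof. by have := w_edge k k.+1; rewrite /underlying_edge eqxx. Qed.

Lemma w_periodic k : w (k + n) = w k.
Proof. by apply/eqP; rewrite w_eq modnDr. Qed.

Lemma w_inj_offset s a b : a < n -> b < n -> w (s + a) = w (s + b) -> a = b.
Proof. by move=> an bn /eqP; rewrite w_eq eqn_modDl !modn_small // => /eqP. Qed.

Lemma w_eqS a b : (w a.+1 == w b.+1) = (w a == w b).
Proof. by rewrite !w_eq -[a.+1]addn1 -[b.+1]addn1 eqn_modDr. Qed.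

Lemma arc_nbr k y : D (w k.+1) y -> y = w k \/ y = w k.+2.
Proof.
have [b ->] := w_surj y => Dy; have := w_edge k.+1 b.
rewrite /underlying_edge Dy /= w_eqS => /esym/orP[]/eqP; first by right.
by left.
Qed.

(** As [m < n], the [m.+1] vertices of the stretch are distinct, so the count of [half_density]
    bounds the size of the complement. *)
Lemma run_density (S : {set V}) s m :
    m < n -> w s \notin S ->
    (forall k, k < m -> (w (s + k.+1) \notin S) || (w (s + k.+2) \notin S)) ->
  m + (w (s + m) \notin S) < 2 * #|~: S|.
Proof.
move=> mn ws run.
have g0 : w (s + 0) \notin S by rewrite addn0.
apply: leq_trans (half_density (g := fun k => w (s + k) \notin S) g0 run) _.
rewrite leq_mul2l /=.
have -> : \sum_(k < m.+1) (w (s + k) \notin S) = #|[set k : 'I_m.+1 | w (s + k) \notin S]|.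
  by rewrite -sum1dep_card [RHS]big_mkcond.
rewrite -(card_imset (f := fun k : 'I_m.+1 => w (s + k))).
  apply/subset_leq_card/subsetP => _ /imsetP[k kS ->].
  by move: kS; rewrite !inE.
move=> k k' /w_inj_offset; have := (ltn_ord k, ltn_ord k') => -[lk lk'] E.
by apply/val_inj/E; lia.
Qed.

Lemma w_neqSS k : w k != w k.+2.
Proof. by rewrite w_eq -{1}[k]addn0 -addn2 eqn_modDl !modn_small //; lia. Qed.

(** With an arc to [w k.+2], the vertex [w k.+1] would force it, because its only other neighbour
    [w k] is already in [S]. [stalled_plus] is the mirror image. *)
Lemma stalled_minus (S : {set V}) k :
    stalled D S -> w k \in S -> w k.+1 \in S -> w k.+2 \notin S ->
  minus k.+1.
Proof.
move=> /stalledP stS k0 k1 k2; rewrite /minus.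
suff nD : ~~ D (w k.+1) (w k.+2) by have := edge_next k.+1; rewrite (negPf nD) /= => ->.
apply/negP => Dw; have [z zS /andP[zk /arc_nbr[] Ez]] := stS _ _ k1 k2 Dw.
  by rewrite Ez k0 in zS.
by rewrite Ez eqxx in zk.
Qed.

Lemma stalled_plus (S : {set V}) k :
    stalled D S -> w k \notin S -> w k.+1 \in S -> w k.+2 \in S ->
  plus k.
Proof.
move=> /stalledP stS k0 k1 k2; rewrite /plus.
suff nD : ~~ D (w k.+1) (w k) by have := edge_next k; rewrite (negPf nD) orbF => ->.
apply/negP => Dw; have [z zS /andP[zk /arc_nbr[] Ez]] := stS _ _ k1 k0 Dw.
  by rewrite Ez eqxx in zk.
by rewrite Ez k2 in zS.
Qed.

Lemma stalled_density (S : {set V}) :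
    stalled D S -> S != setT ->
  n <= 2 * #|~: S| \/
  exists i l, [/\ minus i, plus (i + l), l < n & l < 2 * #|~: S|].
Proof.
move=> stS ST.
have [x xS] : exists x, x \notin S.
  by apply/existsP; rewrite -negb_forall; apply: contra ST => /forallP allS;
    apply/eqP/setP => x; rewrite inE allS.
have [x0 Ex] := w_surj x; rewrite {x}Ex in xS.
pose gap k := (w k \in S) && (w k.+1 \in S).
case: (pickP [pred k : 'I_n | gap (x0 + k)]) => [k /= gapk|nogap]; last first.
  left; have run k : k < n.-1 -> (w (x0 + k.+1) \notin S) || (w (x0 + k.+2) \notin S).
    move=> kn; have kn' : k.+1 < n by lia.
    by have /= := nogap (Ordinal kn'); rewrite /gap -negb_and -addnS => ->.
  by have := run_density (m := n.-1) _ xS run; lia.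
(* Going forward from the gap, take the first vertex outside [S]; it exists because a full turn
   leads back to [w x0]. *)
have [i [gapi iS]] : exists i, gap i /\ w i.+2 \notin S.
  have exd : exists d, w (x0 + k + d) \notin S.
    by exists (n - k); rewrite -addnA subnKC ?w_periodic //; apply: ltnW.
  have [d dS mind] := ex_minnP exd; case: d => [|[|d]] in dS mind *.
  - by move: dS gapk; rewrite addn0 /gap => /negPf->.
  - by move: dS gapk; rewrite addn1 /gap andbC => /negPf->.
  exists (x0 + k + d); split; last by rewrite -!addnS.
  rewrite /gap -addnS; apply/andP; split; apply/negPn/negP => /mind; lia.
right; have /andP[i0 i1] := gapi.
(* The gap at [i] recurs after a full turn, so the first gap beyond [w i.+2] has [m <= n - 3], which
   keeps the stretch shorter than the cycle. *)
have gapn : gap (i.+2 + (n - 3)).+1.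
  have -> : (i.+2 + (n - 3)).+1 = i + n by clear -n_gt2; lia.
  by rewrite /gap -addSn !w_periodic.
have [m gapm minm] := ex_minnP (ex_intro (fun m => gap (i.+2 + m).+1) _ gapn).
have mn : m.+2 < n by have := minm _ gapn; clear -n_gt2; lia.
have /andP[m1 m2] := gapm.
have run k' : k' < m ->
    (w (i.+2 + k'.+1) \notin S) || (w (i.+2 + k'.+2) \notin S).
  rewrite -negb_and !addnS => lt_km; apply/negP => /minm.
  by rewrite leqNgt lt_km.
(* For [m = 0] this is [iS]; otherwise a gap would start one vertex earlier, against the minimality
   of [m]. *)
have mS : w (i.+2 + m) \notin S.
  case: m => [|m] in minm m1 {m2 gapm mn run} *; first by rewrite addn0.
  apply/negP => mS; suff : m < m by rewrite ltnn.
  by apply: minm; rewrite /gap -!addnS mS addnS.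
have dens := run_density (ltnW (ltnW mn)) iS run; rewrite mS addn1 in dens.
exists i.+1, m.+1; split; [exact: stalled_minus stS i0 i1 iS | | exact: ltnW | by []].
by rewrite -addSnnS; apply: (stalled_plus stS mS m1 m2).
Qed.

(* Every second vertex of the stretch [i + 1 .. i + l], and its last one, stay
   outside the set: the arcs at both ends of the stretch point outwards. *)
Lemma alternating_stalled i l :
    #|V| = n -> 0 < l -> l < n -> minus i -> plus (i + l) ->
    (forall k, i < k -> k < i + l -> both k) ->
  n - 1 - l %/ 2 <= failed_zero_forcing_number D.
Proof.
move=> cardV l_gt0 ln /andP[_ mi] /andP[_ pl] bothP.
(* Offsets count from [i.+1]. For even [l] the cap turns the final value [l] into the last offset
   [l.-1]; for odd [l] the last offset is even and occurs anyway. *)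
pose off t := minn (t.*2) l.-1.
pose W := [set w (i.+1 + off t) | t : 'I_(l %/ 2).+1].
have WP o : o < l -> ~~ odd o || (o == l.-1) -> w (i.+1 + o) \in W.
  move=> ol oP.
  have ot : o./2 + (o == l.-1) * odd o < (l %/ 2).+1 by move: oP; lia.
  apply/imsetP; exists (Ordinal ot) => //=; congr (w (_ + _)).
  by rewrite /off; move: oP; lia.
have cardW : #|W| <= (l %/ 2).+1 by rewrite -[X in _ <= X]card_ord leq_imset_card.
have cardWC : #|~: W| = n - #|W| by rewrite cardsCs setCK cardV.
apply: leq_trans (stalled_leq (S := ~: W) _ _); first by lia.
  apply/stalledP => x y; rewrite !inE negbK => xW /imsetP[t _ Ey] Dxy.
  have {t Ey}[o [ol oP Ey]] : exists o, [/\ o < l, ~~ odd o || (o == l.-1) & y = w (i.+1 + o)].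
    exists (off t); split => //; rewrite /off; have := ltn_ord t; lia.
  have {}arcs : x = w (i.+1 + o).+1 \/ x = w (i + o).
    have [b Eb] := w_surj x; have := w_edge b (i.+1 + o).
    rewrite /underlying_edge -Eb -Ey Dxy /= => /esym/orP[]/eqP E; last by left.
    right; apply/eqP; rewrite Eb -w_eqS; apply/eqP; rewrite -E Ey; congr w; lia.
  (* If [x] follows [y], either [y] ends the stretch and [pl] excludes the arc, or [x] lies between
     two vertices of [W] and double arcs join it to both. The other case is symmetric, with [mi]. *)
  case: arcs => Ex.
  - have ol1 : o.+2 < l.
      case: (eqVneq o l.-1) => [El|oneq].
        case/negP: pl; move: Dxy; rewrite Ex Ey; congr (D (w _) (w _)); lia.
      rewrite ltn_neqAle; apply/andP; split; last lia.
      apply/eqP => El; case/negP: xW; rewrite Ex -addnS; apply: WP; lia.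
    exists (w (i.+1 + o.+2)); rewrite ?inE ?negbK; first by apply: WP; lia.
    apply/andP; split.
      by apply/eqP; rewrite Ey => /w_inj_offset; lia.
    have /andP[Dxz _] : both (i.+1 + o.+1) by apply: bothP; lia.
    by rewrite Ex !addnS in Dxz *.
  - case: o => [|o] in ol oP Ey Ex *.
      by case/negP: mi; move: Dxy; rewrite Ex Ey !addn0.
    have oo : odd o.
      apply/negPn/negP => oe; case/negP: xW; rewrite Ex -addSnnS; apply: WP; lia.
    exists (w (i.+1 + o.-1)); rewrite ?inE ?negbK; first by apply: WP; lia.
    apply/andP; split.
      by apply/eqP; rewrite Ey => /w_inj_offset; lia.
    have /andP[_ Dxz] : both (i.+1 + o.-1) by apply: bothP; lia.
    rewrite Ex; have -> : i + o.+1 = (i.+1 + o.-1).+1 by lia.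
    by [].
apply/eqP => /setP/(_ (w (i.+1 + 0))); rewrite !inE => /negP; apply.
exact: WP.
Qed.

End WeakCycle.

Lemma min_cyc_distP n (I J : {set 'I_n}) :
    I != set0 -> J != set0 ->
  (exists2 i, i \in I & exists2 j, j \in J & min_cyc_dist I J = cyc_dist i j) /\
  (forall i j, i \in I -> j \in J -> min_cyc_dist I J <= cyc_dist i j).
Proof.
move=> /set0Pn[i0 Ii0] /set0Pn[j0 Jj0]; rewrite /min_cyc_dist -minEnat.
(* Since the default [n] bounds every distance, both nested minima are attained. *)
have cyc_le (i j : 'I_n) : cyc_dist i j <= n.
  exact: ltnW (ltn_pmod _ (leq_ltn_trans (leq0n i) (ltn_ord i))).
have rowP i : exists2 j, j \in J & \big[Order.min/n]_(j in J) cyc_dist i j = cyc_dist i j.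
  rewrite (bigmin_eq_arg _ _ _ _ Jj0) => [|j _]; last by rewrite leEnat.
  by case: arg_minP => // j Jj _; exists j.
split.
  rewrite (bigmin_eq_arg _ _ _ _ Ii0) => [|i _].
    by case: arg_minP => // i Ii _; exists i => //; apply: rowP.
  by have [j _ ->] := rowP i; rewrite leEnat.
move=> i j Ii Jj; rewrite -leEnat.
exact: le_trans (bigmin_le_cond _ _ Ii) (bigmin_le_cond _ _ Jj).
Qed.

Theorem theorem4p10 (V : finType) (D : digraph V) (n : nat) (v : 'I_n -> V)
    (D_cycle : weak_cycle_labeling D v)
    (V0_neq0 : V_zero D v != set0)
    (Vm_neq0 : V_minus D v != set0)
    (Vp_neq0 : V_plus D v != set0) :
  failed_zero_forcing_number D =
    n - 1 - (min_cyc_dist (V_minus D v) (V_plus D v)) %/ 2.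
Proof.
have [n_gt2 v_bij v_edge] := D_cycle.
have n_gt0 : 0 < n by lia.
pose ord k := Ordinal (ltn_pmod k n_gt0).
pose w k := v (ord k).
have ordP (i : 'I_n) k : k = i %[mod n] -> ord k = i.
  by move=> E; apply/val_inj; rewrite /= E modn_small.
have ordSE k : ordS (ord k) = ord k.+1.
  by apply/val_inj; rewrite /= -addn1 modnDml addn1.
have w_eq a b : (w a == w b) = (a == b %[mod n]).
  by rewrite /w (inj_eq (bij_inj v_bij)).
have w_surj x : exists k, x = w k.
  have [v' _ v'K] := v_bij; exists (v' x).
  by rewrite /w (ordP (v' x)) // v'K.
have w_edge a b :
    underlying_edge D (w a) (w b) = (w b == w a.+1) || (w a == w b.+1).
  by rewrite v_edge !ordSE /w !(inj_eq (bij_inj v_bij)).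
have cardV : #|V| = n by rewrite -(bij_eq_card v_bij) card_ord.
have minusE k : (ord k \in V_minus D v) = minus D w k by rewrite inE ordSE.
have plusE k : (ord k \in V_plus D v) = plus D w k by rewrite inE ordSE.
have distE i l : l < n -> cyc_dist (ord i) (ord (i + l)) = l.
  move=> ln; rewrite /cyc_dist /= -addnBA; last by rewrite ltnW ?ltn_pmod.
  apply/eqP; rewrite -[X in _ == X](modn_small ln) -(eqn_modDl (i %% n)).
  rewrite addnCA subnKC; last by rewrite ltnW ?ltn_pmod.
  by rewrite modnDr modn_mod modnDml.
have ord_offset (i j : 'I_n) : ord (i + cyc_dist i j) = j.
  apply: ordP; rewrite modnDmr addnC subnK ?modnDr //.
  by rewrite (leq_trans (ltnW (ltn_ord i))) ?leq_addl.
have [[i Ii [j Jj minE]] min_le] := min_cyc_distP Vm_neq0 Vp_neq0.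
set l := min_cyc_dist _ _ in minE min_le *.
have ln : l < n by rewrite minE ltn_pmod.
have mi : minus D w i by rewrite -minusE (ordP i).
have pl : plus D w (i + l) by rewrite -plusE minE ord_offset.
have l_gt0 : 0 < l.
  rewrite lt0n; apply: contraTneq pl => ->; rewrite addn0 /plus.
  by case/andP: mi => _ /negPf->.
apply/eqP; rewrite eqn_leq; apply/andP; split; last first.
  apply: (alternating_stalled n_gt2 w_eq w_surj w_edge cardV l_gt0 ln mi pl) => k ik kl.
  (* An index of [V_minus] strictly inside the stretch would be closer to [j], and one of [V_plus]
     closer to [i], than [l]; only double arcs remain. *)
  have Nm : ~~ minus D w k.
    apply/negP; rewrite -minusE => /min_le/(_ Jj).
    have -> : j = ord (k + (i + l - k)) by rewrite subnKC ?(ltnW kl) // minE ord_offset.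
    by rewrite distE; lia.
  have Np : ~~ plus D w k.
    apply/negP; rewrite -plusE => kp; have := min_le _ _ Ii kp.
    rewrite -(ordP i i) // -[k](subnKC (ltnW ik)) distE; lia.
  have := edge_next w_edge k; move: Nm Np; rewrite /minus /plus /both.
  by case: (D _ _); case: (D _ _).
have [S /andP[stS ST] <-] := failed_number_stalled D.
have := cardsC S; rewrite cardV.
(* Both alternatives give [l < 2 * #|~: S|]: the first through [l < n], the second through
   [l <= l']. *)
case: (stalled_density n_gt2 w_eq w_surj w_edge stS ST) => [|[i' [l' [mi' pl' ln' ll']]]].
  by lia.
have := min_le (ord i') (ord (i' + l')); rewrite minusE plusE distE // => /(_ mi' pl').
by lia.
Qed.
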